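(* Let $\mathcal H$ be a complex separable infinite-dimensional Hilbert space, let $T\in GL(\mathcal H)$ and let $f_0\in\mathcal V_{\mathbb Z}(T)$. Then $$\mathcal V_{\mathbb Z}(T)=\left\{Vf_0:V\in\{T\}'\cap GL(\mathcal H)\right\}.$$
   Context: $L(\mathcal H)$ is the set of bounded linear operators on $\mathcal H$, $GL(\mathcal H)$ the set of bijective ones. $\mathcal V_{\mathbb Z}(T):=\{f\in\mathcal H:(T^nf)_{n\in\mathbb Z}\text{ is a frame for }\mathcal H\}$, where a system $(f_n)_{n\in I}$ is a frame for $\mathcal H$ if there are $A,B>0$ with $A\|f\|^2\le\sum_{n\in I}|\langle f,f_n\rangle|^2\le B\|f\|^2$ for all $f\in\mathcal H$. $\{T\}'$ is the commutant of $T$, i.e. the set of all $V\in L(\mathcal H)$ commuting with $T$. *)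

(* Defs.v *)
From HB Require Import structures.
From mathcomp Require Import all_boot all_order all_algebra.
From mathcomp Require Import complex.
From mathcomp Require Import all_classical all_reals all_analysis.

Set Implicit Arguments.
Unset Strict Implicit.
Unset Printing Implicit Defensive.

Import Order.TTheory GRing.Theory Num.Theory.
Import numFieldNormedType.Exports.

Local Open Scope classical_set_scope.
Local Open Scope ring_scope.
Local Open Scope complex_scope.

(* The norm of a normed space over R[i] takes its values in the nonnegative
   reals seen inside R[i]; [rnorm] is the same number, as an element of R.
   It applies to vectors and, on R[i] itself, to complex scalars. *)
Definition rnorm (R : realType) (V : normedZmodType R[i]) (x : V) : R :=
  complex.Re `|x|.

Section Hilbert.
Variables (R : realType) (H : completeNormedModType R[i]).

Definition separable : Prop := exists2 D : set H, countable D & dense D.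

(* No finite family of vectors spans H. *)
Definition infinite_dimensional : Prop :=
  forall (n : nat) (e : 'I_n -> H),
    exists x : H, forall c : 'I_n -> R[i], x <> \sum_(i < n) c i *: e i.

(* The set L(H); see [linear_boundedP] for the equivalence with
   the operator-norm bound |V x| <= r |x|. *)
Definition bounded_ops : set {linear H -> H} :=
  [set V : {linear H -> H} | bounded_near V (nbhs (0 : H))].

Definition GL : set {linear H -> H} :=
  bounded_ops `&` [set V : {linear H -> H} | bijective V].

Definition commutant (T : {linear H -> H}) : set {linear H -> H} :=
  bounded_ops `&` [set V : {linear H -> H} | V \o T = T \o V].

(* [zpow T n] is T^n for n in Z; negative powers are iterates of the inverse
   function of T, and are meaningful only when T is bijective. *)
Definition zpow (T : H -> H) (n : int) : H -> H :=
  match n with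
  | Posz k => iter k T
  | Negz k => iter k.+1 ('pinv_(fun=> 0) [set: H] T)
  end.

(* [dot] is linear in its first argument and conjugate-linear in the second;
   H is a Hilbert space for it when dot x x = `|x| ^+ 2 for every x. *)
Variable dot : {dot H for (@Num.conj R[i])}.

(* The sum ranges over an arbitrary index set; it is the supremum
   in [0, +oo] of the finite partial sums. *)
Definition frame (I : choiceType) (u : I -> H) : Prop :=
  exists A B : R, [/\ 0 < A, 0 < B & forall f : H,
    ((A * rnorm f ^+ 2)%:E <=
       \esum_(i in [set: I]) (rnorm (dot f (u i)) ^+ 2)%:E)%E /\
    (\esum_(i in [set: I]) (rnorm (dot f (u i)) ^+ 2)%:E <=
       (B * rnorm f ^+ 2)%:E)%E].

(* The set V_Z(T) of generators of frames of the form (T^n f), n in Z. *)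
Definition frame_generators (T : {linear H -> H}) : set H :=
  [set f : H | frame (fun n : int => zpow T n f)].

End Hilbert.

Arguments separable {R} H.
Arguments infinite_dimensional {R} H.
Arguments GL {R} H.
Arguments bounded_ops {R} H.

(* Main.v *)
(* Let [u_i n = T^n f_i] ([i = 0, 1]) be the two frames, [C_i x = (<x, u_i n>)_n]
   the analysis operators and [D_i] the inverses of the frame operators, so that
   [<C_i y, C_i (D_i x)> = <y, x>] in [l^2(Z)].  Shift invariance gives
   [T^* D_i T = D_i], hence the Gram matrix [<D_i u_i m, u_i n>] of the canonical
   dual against the frame depends only on [n - m].  Writing [G_0] and [G_1] for
   these two projections of [l^2(Z)], the cross Gram matrices [X] and [Y] are
   Laurent matrices with [G_0 = X Y] and [G_1 = Y X]; Laurent matrices commute,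
   so [G_0 = G_1].  Therefore [V x = sum_n <D_0 x, u_0 n> u_1 n], defined weakly by
   [<y, V x> = <C_1 y, C_0 (D_0 x)>], commutes with [T], maps [f_0] to [f_1], and
   satisfies [C_1 D_1 V = C_0 D_0]; exchanging the two frames gives its inverse.
   Conversely, if [V] is bijective, bounded and commutes with [T], then [V^*] is
   bounded below, and [<f, T^n V f_0> = <V^* f, T^n f_0>]. *)
Require Import Defs.
From HB Require Import structures.
From mathcomp Require Import all_boot all_order all_algebra.
From mathcomp Require Import complex.
From mathcomp Require Import all_classical all_reals all_analysis.
From mathcomp Require Import ring lra.

Import Order.TTheory GRing.Theory Num.Theory.
Import numFieldNormedType.Exports.

Local Open Scope classical_set_scope.
Local Open Scope ring_scope.
Local Open Scope complex_scope.

Set Implicit Arguments.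
Unset Strict Implicit.
Unset Printing Implicit Defensive.

(** * Sums over an arbitrary index set *)

Section RealSums.
Context {R : realType} {I : choiceType}.
Implicit Types (f g p q : I -> R) (r : R).

Definition nnsum f : \bar R := (\esum_(i in [set: I]) (f i)%:E)%E.

Lemma nnsum_ge0 f : (forall i, 0 <= f i) -> (0 <= nnsum f)%E.
Proof. by move=> f0; apply: esum_ge0 => i _; rewrite lee_fin. Qed.

Lemma le_nnsum f g : (forall i, f i <= g i) -> (nnsum f <= nnsum g)%E.
Proof. by move=> fg; apply: le_esum => i _; rewrite lee_fin. Qed.

Lemma nnsumD f g : (forall i, 0 <= f i) -> (forall i, 0 <= g i) ->
  nnsum (fun i => f i + g i) = (nnsum f + nnsum g)%E.
Proof.
move=> f0 g0; rewrite /nnsum -esumD//; first last.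
- by move=> i _; rewrite lee_fin.
- by move=> i _; rewrite lee_fin.
Qed.

Lemma nnsumZ_le r f : 0 <= r -> (forall i, 0 <= f i) ->
  (nnsum (fun i => (r * f i)%R) <= r%:E * nnsum f)%E.
Proof.
move=> r0 f0; apply: ge_ereal_sup => _ [A AS <-].
rewrite (eq_fsbigr (fun i => (r%:E * (f i)%:E)%E))// -ge0_mule_fsumr//.
by apply: lee_wpmul2l; rewrite ?lee_fin//; apply: ereal_sup_ubound; exists A.
Qed.

Lemma reindex_nnsum (J : choiceType) (e : I -> J) (h : J -> R) :
  bijective e -> nnsum (fun i => h (e i)) = (\esum_(j in [set: J]) (h j)%:E)%E.
Proof.
move=> be; rewrite (@reindex_esum _ _ _ [set: I] [set: J] e)//.
split=> //; first exact: in2W (bij_inj be).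
by move=> y _; case: be => e' _ ke; exists (e' y).
Qed.

Definition summable_real f := (nnsum (fun i => `|f i|%R) < +oo)%E.

Lemma summable_real_fin f : (forall i, 0 <= f i) -> (nnsum f < +oo)%E ->
  nnsum f \is a fin_num.
Proof. by move=> f0 foo; rewrite ge0_fin_numE// nnsum_ge0. Qed.

Lemma summable_real_le f g : (forall i, `|f i| <= g i) -> (nnsum g < +oo)%E ->
  summable_real f.
Proof. by move=> fg; apply: le_lt_trans; apply: le_nnsum. Qed.

(* Meaningful only for summable [f]: [fine] sends [+oo] to [0]. *)
Definition rsum f : R := fine (nnsum (fun i => Num.max (f i) 0)) -
  fine (nnsum (fun i => Num.max (- f i) 0)).

(** With [fp] and [fn] the positive and negative parts of [f], the identity [fp + q = p + fn] holds
    termwise between nonnegative summable families. This freedom in the decomposition is what makes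
    [rsum] additive and homogeneous. *)
Lemma rsum_unique f p q : (forall i, 0 <= p i) -> (forall i, 0 <= q i) ->
  (forall i, f i = p i - q i) -> (nnsum p < +oo)%E -> (nnsum q < +oo)%E ->
  rsum f = fine (nnsum p) - fine (nnsum q).
Proof.
move=> p0 q0 fpq poo qoo; rewrite /rsum.
set fp := fun i => Num.max (f i) 0; set fn := fun i => Num.max (- f i) 0.
have fp0 i : 0 <= fp i by rewrite le_max lexx orbT.
have fn0 i : 0 <= fn i by rewrite le_max lexx orbT.
have fpoo : (nnsum fp < +oo)%E.
  apply: le_lt_trans poo; apply: le_nnsum => i; rewrite /fp fpq ge_max p0 andbT.
  by rewrite gerBl.
have fnoo : (nnsum fn < +oo)%E.
  apply: le_lt_trans qoo; apply: le_nnsum => i.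
  by rewrite /fn fpq ge_max q0 andbT opprB gerBl.
have E : nnsum (fun i => fp i + q i) = nnsum (fun i => p i + fn i).
  congr nnsum; apply/funext => i; rewrite /fp /fn fpq.
  rewrite /Num.max; do 2 case: ltP => ?; lra.
have := congr1 fine E; rewrite !nnsumD// !fineD ?summable_real_fin//.
by move=> /eqP; rewrite -subr_eq => /eqP <-; lra.
Qed.

Lemma rsum_ge0 f : (forall i, 0 <= f i) -> (nnsum f < +oo)%E ->
  rsum f = fine (nnsum f).
Proof.
move=> f0 foo; rewrite (@rsum_unique f f (fun=> 0))//.
- by rewrite {2}/nnsum esum1// subr0.
- by move=> i; rewrite subr0.
- by rewrite /nnsum esum1.
Qed.

Lemma rsum_le f g : (forall i, `|f i| <= g i) -> (nnsum g < +oo)%E ->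
  `|rsum f| <= fine (nnsum g).
Proof.
move=> fg goo.
have g0 i : 0 <= g i by apply: le_trans (fg i).
have b h : (forall i, 0 <= h i) -> (forall i, h i <= g i) ->
    0 <= fine (nnsum h) <= fine (nnsum g).
  move=> h0 hg; rewrite fine_ge0 ?nnsum_ge0//= fine_le ?le_nnsum//.
    by rewrite summable_real_fin//; apply: le_lt_trans goo; apply: le_nnsum.
  by rewrite summable_real_fin.
have /andP[p0 pg] : 0 <= fine (nnsum (fun i => Num.max (f i) 0)) <= fine (nnsum g).
  apply: b => i; first by rewrite le_max lexx orbT.
  by rewrite ge_max g0 andbT (le_trans _ (fg i))// ler_norm.
have /andP[n0 ng] : 0 <= fine (nnsum (fun i => Num.max (- f i) 0)) <= fine (nnsum g).
  apply: b => i; first by rewrite le_max lexx orbT.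
  by rewrite ge_max g0 andbT (le_trans _ (fg i))// -normrN ler_norm.
rewrite ler_norml /rsum; lra.
Qed.

Lemma summable_real_pos f : summable_real f ->
  (nnsum (fun i => Num.max (f i) 0%R) < +oo)%E.
Proof.
apply: le_lt_trans; apply: le_nnsum => i.
by rewrite ge_max normr_ge0 andbT ler_norm.
Qed.

Lemma summable_real_neg f : summable_real f ->
  (nnsum (fun i => Num.max (- f i)%R 0%R) < +oo)%E.
Proof.
apply: le_lt_trans; apply: le_nnsum => i.
by rewrite ge_max normr_ge0 andbT -normrN ler_norm.
Qed.

Lemma rsumD f g : summable_real f -> summable_real g ->
  rsum (fun i => f i + g i) = rsum f + rsum g.
Proof.
move=> sf sg.
have [fp fn] := (summable_real_pos sf, summable_real_neg sf).
have [gp gn] := (summable_real_pos sg, summable_real_neg sg).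
have M0 (x : R) : 0 <= Num.max x 0 by rewrite le_max lexx orbT.
have ME (x : R) : x = Num.max x 0 - Num.max (- x) 0.
  by rewrite /Num.max; do 2 case: ltP => ?; lra.
have oo p q : (forall i, 0 <= p i) -> (forall i, 0 <= q i) ->
    (nnsum p < +oo)%E -> (nnsum q < +oo)%E ->
    (nnsum (fun i => (p i + q i)%R) < +oo)%E /\
    fine (nnsum (fun i => p i + q i)) = fine (nnsum p) + fine (nnsum q).
  move=> p0 q0 poo qoo.
  by rewrite nnsumD// lte_add_pinfty// fineD// summable_real_fin.
have [fgp fgpE] := oo _ _ (fun i => M0 (f i)) (fun i => M0 (g i)) fp gp.
have [fgn fgnE] := oo _ _ (fun i => M0 (- f i)) (fun i => M0 (- g i)) fn gn.
rewrite (rsum_unique _ _ _ fgp fgn).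
- by rewrite fgpE fgnE /rsum; lra.
- by move=> i; rewrite addr_ge0.
- by move=> i; rewrite addr_ge0.
- by move=> i; have := ME (f i); have := ME (g i); lra.
Qed.

Lemma rsumN f : rsum (fun i => - f i) = - rsum f.
Proof.
by rewrite /rsum opprB; under [X in _ - fine (nnsum X)]eq_fun do rewrite opprK.
Qed.

(** One inequality is [nnsumZ_le] for [r]; the other is [nnsumZ_le] for [r^-1], applied to the
    family [r * f i]. *)
Lemma fine_nnsumZ r f : 0 <= r -> (forall i, 0 <= f i) -> (nnsum f < +oo)%E ->
  fine (nnsum (fun i => r * f i)) = r * fine (nnsum f).
Proof.
move=> r0 f0 foo; have [->|rn0] := eqVneq r 0.
  by rewrite mul0r /nnsum esum1// => i _; rewrite mul0r.
have rf0 i : 0 <= r * f i by rewrite mulr_ge0.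
have ffin := summable_real_fin f0 foo.
have le1 := nnsumZ_le r0 f0.
have rfoo : (nnsum (fun i => (r * f i)%R) < +oo)%E.
  by apply: le_lt_trans le1 _; rewrite -(fineK ffin) -EFinM ltry.
have rffin := summable_real_fin rf0 rfoo.
apply/eqP; rewrite eq_le -lee_fin EFinM !fineK// le1/=.
rewrite -ler_pdivlMl ?lt_def ?rn0// -lee_fin EFinM !fineK//.
apply: le_trans (nnsumZ_le _ rf0); last by rewrite invr_ge0.
by apply: le_nnsum => i; rewrite mulKf.
Qed.

Lemma rsumZ r f : summable_real f -> rsum (fun i => r * f i) = r * rsum f.
Proof.
move=> sf; wlog r0 : r / 0 <= r.
  move=> H; have [/H//|r0] := leP 0 r.
  rewrite -[r]opprK mulNr -H ?oppr_ge0 ?(ltW r0)// -rsumN.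
  by congr rsum; apply/funext => i; rewrite mulNr.
have [fp fn] := (summable_real_pos sf, summable_real_neg sf).
have M0 (x : R) : 0 <= Num.max x 0 by rewrite le_max lexx orbT.
have rM0 (x : R) : 0 <= r * Num.max x 0 by rewrite mulr_ge0.
have oo h : (forall i, 0 <= h i) -> (nnsum h < +oo)%E ->
    (nnsum (fun i => (r * h i)%R) < +oo)%E.
  move=> h0 hoo; apply: le_lt_trans (nnsumZ_le r0 h0) _.
  by rewrite -(fineK (summable_real_fin h0 hoo)) -EFinM ltry.
have fE i : r * f i = r * Num.max (f i) 0 - r * Num.max (- f i) 0.
  by rewrite -mulrBr /Num.max; congr (_ * _); do 2 case: ltP => ?; lra.
rewrite (rsum_unique (fun i => rM0 (f i)) (fun i => rM0 (- f i)) fE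
  (oo _ (fun i => M0 (f i)) fp) (oo _ (fun i => M0 (- f i)) fn)).
rewrite (fine_nnsumZ r0 (fun i => M0 (f i)) fp).
by rewrite (fine_nnsumZ r0 (fun i => M0 (- f i)) fn) -mulrBr.
Qed.

Lemma summable_realD f g : summable_real f -> summable_real g ->
  summable_real (fun i => f i + g i).
Proof.
move=> sf sg; apply: (@summable_real_le _ (fun i => `|f i| + `|g i|)) => [i|].
  exact: ler_normD.
by rewrite nnsumD// lte_add_pinfty.
Qed.

Lemma summable_realZ r f : summable_real f -> summable_real (fun i => r * f i).
Proof.
move=> sf; apply: (@summable_real_le _ (fun i => `|r| * `|f i|)) => [i|].
  by rewrite normrM.
apply: le_lt_trans (nnsumZ_le _ _) _ => //.
by rewrite -(fineK (summable_real_fin _ sf))// -EFinM ltry.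
Qed.

End RealSums.

Lemma reindex_rsum (R : realType) (I J : choiceType) (e : I -> J) (h : J -> R) :
  bijective e -> rsum (fun i => h (e i)) = rsum h.
Proof.
by move=> be; rewrite /rsum (reindex_nnsum (fun j => Num.max (h j) 0))//
  (reindex_nnsum (fun j => Num.max (- h j) 0)).
Qed.

(** * Real-valued norms of vectors and complex scalars *)

Section RealNorm.
Context {R : realType}.

Section NormedZmod.
Context {V : normedZmodType R[i]}.
Implicit Types x y : V.

Lemma rnormE x : `|x| = (rnorm x)%:C.
Proof. by rewrite /rnorm RRe_real// normr_real. Qed.

Lemma rnorm_ge0 x : 0 <= rnorm x.
Proof. by rewrite -ler0c -rnormE. Qed.

Lemma rnorm_eq0 x : (rnorm x == 0) = (x == 0).
Proof. by rewrite -(normr_eq0 x) rnormE (inj_eq (@complexI R) _ 0). Qed.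

Lemma rnorm0 : rnorm (0 : V) = 0.
Proof. by apply/eqP; rewrite rnorm_eq0. Qed.

Lemma rnormN x : rnorm (- x) = rnorm x.
Proof. by rewrite /rnorm normrN. Qed.

Lemma ler_rnormD x y : rnorm (x + y) <= rnorm x + rnorm y.
Proof. by rewrite -lecR rmorphD/= -!rnormE ler_normD. Qed.

Lemma ler_rnormB x y : rnorm (x - y) <= rnorm x + rnorm y.
Proof. by rewrite -(rnormN y) ler_rnormD. Qed.

Lemma rdistC x y : rnorm (x - y) = rnorm (y - x).
Proof. by rewrite -rnormN opprB. Qed.
End NormedZmod.

Lemma rnormM (z w : R[i]) : rnorm (z * w) = rnorm z * rnorm w.
Proof. by apply: (@complexI R); rewrite rmorphM/= -!rnormE normrM. Qed.

Lemma rnormZ (V : normedModType R[i]) (k : R[i]) (x : V) :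
  rnorm (k *: x) = rnorm k * rnorm x.
Proof. by apply: (@complexI R); rewrite rmorphM/= -!rnormE normrZ. Qed.

Lemma rnorm_real (r : R) : rnorm r%:C = `|r|.
Proof. by rewrite /rnorm normc_def/= expr0n addr0 sqrtr_sqr. Qed.

Lemma rnormJ (z : R[i]) : rnorm z^*%C = rnorm z.
Proof. by rewrite /rnorm normcJ. Qed.

Lemma rnorm_sqr (z : R[i]) : rnorm z ^+ 2 = complex.Re z ^+ 2 + complex.Im z ^+ 2.
Proof. by apply: (@complexI R); rewrite rmorphXn/= -rnormE add_Re2_Im2. Qed.

Lemma mulcJ (z : R[i]) : z * z^*%C = (rnorm z ^+ 2)%:C.
Proof. by rewrite -sqr_normc rnormE rmorphXn. Qed.

Lemma norm_Re_le (z : R[i]) : `|complex.Re z| <= rnorm z.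
Proof. by rewrite -lecR -rnormE normc_ge_Re. Qed.

Lemma norm_Im_le (z : R[i]) : `|complex.Im z| <= rnorm z.
Proof.
rewrite -(ler_pXn2r (ltn0Sn 1)) ?nnegrE ?rnorm_ge0// rnorm_sqr.
by rewrite real_normK ?num_real// lerDr sqr_ge0.
Qed.

Lemma rnorm_le_ReIm (z : R[i]) : rnorm z <= `|complex.Re z| + `|complex.Im z|.
Proof.
rewrite -(ler_pXn2r (ltn0Sn 1)) ?nnegrE ?rnorm_ge0 ?addr_ge0// rnorm_sqr sqrrD.
by rewrite !real_normK ?num_real// lerD2r lerDl mulrn_wge0 ?mulr_ge0.
Qed.
End RealNorm.

(** * Complex sums and the inner product of [l^2] *)

Section ComplexSums.
Context {R : realType} {I : choiceType}.
Implicit Types (a b c : I -> R[i]) (k : R[i]).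

Definition summable_complex c := summable_real (fun i => rnorm (c i)).

Definition csum c : R[i] :=
  rsum (fun i => complex.Re (c i)) +i* rsum (fun i => complex.Im (c i)).

Lemma summable_complexE c :
  summable_complex c = (nnsum (fun i => rnorm (c i)) < +oo)%E.
Proof.
rewrite /summable_complex /summable_real.
by under eq_fun do rewrite ger0_norm ?rnorm_ge0//.
Qed.

Lemma summable_Re c : summable_complex c ->
  summable_real (fun i => complex.Re (c i)).
Proof.
rewrite summable_complexE.
exact/summable_real_le/(fun i => norm_Re_le (c i)).
Qed.

Lemma summable_Im c : summable_complex c ->
  summable_real (fun i => complex.Im (c i)).
Proof.
rewrite summable_complexE.
exact/summable_real_le/(fun i => norm_Im_le (c i)).
Qed.

Lemma csum_linear k a b : summable_complex a -> summable_complex b ->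
  csum (fun i => k * a i + b i) = k * csum a + csum b.
Proof.
move=> sa sb; have [sar sai] := (summable_Re sa, summable_Im sa).
have [sbr sbi] := (summable_Re sb, summable_Im sb).
case: k => kr ki; rewrite /csum; simpc.
have -> : (fun i => complex.Re ((kr +i* ki) * a i + b i)) =
    (fun i => kr * complex.Re (a i) + - ki * complex.Im (a i) +
      complex.Re (b i)).
  by apply/funext => i; case: (a i) (b i) => ? ? [? ?] /=; rewrite mulNr.
have -> : (fun i => complex.Im ((kr +i* ki) * a i + b i)) =
    (fun i => kr * complex.Im (a i) + ki * complex.Re (a i) +
      complex.Im (b i)).
  by apply/funext => i; case: (a i) (b i) => ? ? [? ?].
have [sar1 sai1] := (summable_realZ kr sar, summable_realZ (- ki) sai).
have [sar2 sai2] := (summable_realZ ki sar, summable_realZ kr sai).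
rewrite (rsumD (summable_realD sar1 sai1) sbr) (rsumD sar1 sai1).
rewrite (rsumD (summable_realD sai2 sar2) sbi) (rsumD sai2 sar2).
by rewrite !rsumZ// mulNr.
Qed.

Lemma csumJ c : csum (fun i => (c i)^*%C) = (csum c)^*%C.
Proof.
rewrite /csum /= -rsumN.
by apply: congr2; apply: congr1; apply/funext => i; case: (c i).
Qed.

(** The factor 2 comes from bounding the real and imaginary sums separately. *)
Lemma rnorm_csum_le c : summable_complex c ->
  rnorm (csum c) <= 2 * fine (nnsum (fun i => rnorm (c i))).
Proof.
rewrite summable_complexE => sc; apply: le_trans (rnorm_le_ReIm _) _ => /=.
rewrite mulr_natl mulr2n.
by rewrite lerD// rsum_le// => i; [exact: norm_Re_le|exact: norm_Im_le].
Qed.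

Definition l2 a := (nnsum (fun i => (rnorm (a i) ^+ 2)%R) < +oo)%E.

Definition l2norm2 a : R := fine (nnsum (fun i => rnorm (a i) ^+ 2)).

Definition l2dot a b : R[i] := csum (fun i => a i * (b i)^*%C).

Lemma rnorm_mul_le (z w : R[i]) :
  rnorm (z * w^*%C) <= 2^-1 * (rnorm z ^+ 2 + rnorm w ^+ 2).
Proof.
rewrite rnormM rnormJ; have := sqr_ge0 (rnorm z - rnorm w).
by rewrite sqrrB -mulr_natl; lra.
Qed.

(** By [rnorm_mul_le] this mean dominates the terms of [l2dot a b]; its finite total gives both
    their summability and the bound [l2dot_le]. *)
Lemma l2_mean a b : l2 a -> l2 b ->
  (nnsum (fun i => (2^-1 * (rnorm (a i) ^+ 2 + rnorm (b i) ^+ 2))%R) < +oo)%E /\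
  fine (nnsum (fun i => 2^-1 * (rnorm (a i) ^+ 2 + rnorm (b i) ^+ 2))) =
    2^-1 * (l2norm2 a + l2norm2 b).
Proof.
move=> la lb.
have sab : (nnsum (fun i => (rnorm (a i) ^+ 2 + rnorm (b i) ^+ 2)%R) < +oo)%E.
  by rewrite nnsumD ?lte_add_pinfty// => i; rewrite sqr_ge0.
have ab0 i : 0 <= rnorm (a i) ^+ 2 + rnorm (b i) ^+ 2 by rewrite addr_ge0 ?sqr_ge0.
split.
  apply: le_lt_trans (nnsumZ_le _ ab0) _; first by rewrite invr_ge0.
  by rewrite -(fineK (summable_real_fin ab0 sab)) -EFinM ltry.
rewrite fine_nnsumZ// ?invr_ge0// nnsumD ?fineD// => [||i|i]; rewrite ?sqr_ge0//.
  by rewrite summable_real_fin// => i; rewrite sqr_ge0.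
by rewrite summable_real_fin// => i; rewrite sqr_ge0.
Qed.

Lemma summable_l2dot a b : l2 a -> l2 b ->
  summable_complex (fun i => a i * (b i)^*%C).
Proof.
move=> la lb; rewrite summable_complexE; have [+ _] := l2_mean la lb.
by apply: le_lt_trans; apply: le_nnsum => i; exact: rnorm_mul_le.
Qed.

Lemma l2dot_linear k a a' b : l2 a -> l2 a' -> l2 b ->
  l2dot (fun i => k * a i + a' i) b = k * l2dot a b + l2dot a' b.
Proof.
move=> la la' lb; rewrite /l2dot -csum_linear ?summable_l2dot//.
by congr csum; apply/funext => i; rewrite mulrDl mulrA.
Qed.

Lemma eq_l2dot a a' b b' : a =1 a' -> b =1 b' -> l2dot a b = l2dot a' b'.
Proof. by move=> /funext -> /funext ->. Qed.

Lemma l2dotC a b : l2dot b a = (l2dot a b)^*%C.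
Proof.
rewrite /l2dot -csumJ; congr csum; apply/funext => i.
by rewrite rmorphM/= conjcK mulrC.
Qed.

Lemma l2dotJ a b : l2dot (fun i => (a i)^*%C) (fun i => (b i)^*%C) = l2dot b a.
Proof. by congr csum; apply/funext => i; rewrite conjcK mulrC. Qed.

Lemma l2dotaa a : l2 a -> l2dot a a = (l2norm2 a)%:C.
Proof.
move=> la; rewrite /l2dot.
have -> : (fun i => a i * (a i)^*%C) = (fun i => (rnorm (a i) ^+ 2)%:C).
  by apply/funext => i; rewrite mulcJ.
have s0 : nnsum (fun _ : I => 0 : R) = 0%E by rewrite /nnsum esum1.
rewrite /csum /= (rsum_ge0 _ la) => [|i]; last exact: sqr_ge0.
by rewrite rsum_ge0 ?s0.
Qed.

(** The 2 of [rnorm_csum_le] cancels the [2^-1] of the mean. A bound by a sum of squares is enough,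
    since [sesqui_le] turns it into a product bound. *)
Lemma l2dot_le a b : l2 a -> l2 b ->
  rnorm (l2dot a b) <= l2norm2 a + l2norm2 b.
Proof.
move=> la lb; apply: le_trans (rnorm_csum_le (summable_l2dot la lb)) _.
have [f E] := l2_mean la lb.
rewrite -[leRHS](mulVKf (_ : 2 != 0 :> R)) ?pnatr_eq0// ler_pM2l ?ltr0n//.
rewrite -E fine_le ?le_nnsum//; last first.
- by move=> i; exact: rnorm_mul_le.
- by rewrite summable_real_fin// => i; rewrite mulr_ge0 ?invr_ge0 ?addr_ge0 ?sqr_ge0.
rewrite summable_real_fin//; first by move=> i; rewrite rnorm_ge0.
by rewrite -summable_complexE summable_l2dot.
Qed.
End ComplexSums.

Lemma reindex_l2dot (R : realType) (I J : choiceType) (e : I -> J)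
    (a b : J -> R[i]) :
  bijective e -> l2dot (fun i => a (e i)) (fun i => b (e i)) = l2dot a b.
Proof.
by move=> be; rewrite /l2dot /csum
  (reindex_rsum (fun j => complex.Re (a j * (b j)^*%C)))//
  (reindex_rsum (fun j => complex.Im (a j * (b j)^*%C))).
Qed.

(** * Sesquilinear forms and the Lax-Milgram lemma *)

Section SmallReals.
Context {R : realType}.

Lemma ex_harmonic_lt (K e : R) : 0 < e -> exists n, K * n.+1%:R^-1 < e.
Proof.
move=> e0; exists (Num.bound `|K / e|); rewrite ltr_pdivrMr ?ltr0n//.
rewrite mulrC -ltr_pdivrMr// (le_lt_trans (ler_norm _))//.
apply: lt_trans (archi_boundP (normr_ge0 _)) _.
by rewrite ltr_nat ltnS.
Qed.

Lemma le0_harmonic (K x : R) : (forall n, x <= K * n.+1%:R^-1) -> x <= 0.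
Proof.
move=> xK; rewrite leNgt; apply/negP => /(ex_harmonic_lt K)[n].
by rewrite ltNge xK.
Qed.
End SmallReals.

Section Operators.
Context {R : realType} {H : completeNormedModType R[i]}.

(** The rate [e] survives in the limit, so that the limit can later be compared with each single
    [s n]. *)
Lemma cauchy_limit (s : nat -> H) (e : nat -> R) :
  (forall m n, (n <= m)%N -> rnorm (s m - s n) <= e n) ->
  (forall eps, 0 < eps -> exists n, e n < eps) ->
  exists x, forall n, rnorm (x - s n) <= e n.
Proof.
move=> se e0.
have sc : cvg (s @ \oo).
  apply/cauchy_cvgP/cauchy_exP => eps eps0.
  have := eps0; rewrite ltcE /= => /andP[/eqP ime ree].
  have [n ne] := e0 _ ree; exists (s n); near=> m.
  rewrite -ball_normE/= rnormE ltcE ime eqxx/=.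
  rewrite rdistC; apply: le_lt_trans ne; apply: se.
  by near: m; exact: nbhs_infty_ge.
exists (lim (s @ \oo)) => n; apply/ler_addgt0Pr => eps eps0.
have /cvgrPdist_lt/(_ eps%:C) := sc; rewrite ltcR => /(_ eps0) near_s.
have [m [mn ms]] : exists m, (n <= m)%N /\ `|lim (s @ \oo) - s m| < eps%:C.
  near \oo => m; exists m; split; first by near: m; exact: nbhs_infty_ge.
  by near: m.
move: ms; rewrite rnormE ltcR => ms.
have -> : lim (s @ \oo) - s n = (lim (s @ \oo) - s m) + (s m - s n).
  by rewrite addrA subrK.
by apply: le_trans (ler_rnormD _ _) _; have := se _ _ mn; lra.
Unshelve. all: by end_near. Qed.

Lemma bounded_opsP (V : {linear H -> H}) : bounded_ops H V <->
  exists M, 0 <= M /\ forall x, rnorm (V x) <= M * rnorm x.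
Proof.
rewrite /bounded_ops/= linear_boundedP; split.
  case=> M [Mreal HM]; exists (`|complex.Re M| + 1).
  split=> [|x]; first by rewrite addr_ge0.
  have := HM (`|complex.Re M| + 1)%:C _ x; rewrite !rnormE -rmorphM/= lecR; apply.
  rewrite -(RRe_real Mreal) ltcR; have := ler_norm (complex.Re M); lra.
case=> M [M0 HM]; exists M%:C; split; first exact/complex_realP/(ex_intro _ M).
move=> r Mr x; apply: (@le_trans _ _ (M%:C * `|x|)).
  by rewrite !rnormE -rmorphM/= lecR.
by rewrite ler_wpM2r// ltW.
Qed.

Definition sesqui_form (b : H -> H -> R[i]) :=
  (forall k x y z, b (k *: x + y) z = k * b x z + b y z) /\
  (forall k x y z, b z (k *: x + y) = k^*%C * b z x + b z y).

Definition bounded_form (b : H -> H -> R[i]) :=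
  exists M, 0 <= M /\ forall x y, rnorm (b x y) <= M * (rnorm x * rnorm y).

Section SesquiForm.
Context (b : H -> H -> R[i]) (bs : sesqui_form b).

Lemma sesquiDl x y z : b (x + y) z = b x z + b y z.
Proof. by have := bs.1 1 x y z; rewrite scale1r mul1r. Qed.
Lemma sesquiDr x y z : b z (x + y) = b z x + b z y.
Proof. by have := bs.2 1 x y z; rewrite scale1r conjc1 mul1r. Qed.
Lemma sesqui0l z : b 0 z = 0.
Proof. by apply: (@addIr _ (b 0 z)); rewrite -sesquiDl !add0r. Qed.
Lemma sesqui0r z : b z 0 = 0.
Proof. by apply: (@addIr _ (b z 0)); rewrite -sesquiDr !add0r. Qed.
Lemma sesquiZl k x z : b (k *: x) z = k * b x z.
Proof. by have := bs.1 k x 0 z; rewrite addr0 sesqui0l addr0. Qed.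
Lemma sesquiZr k x z : b z (k *: x) = k^*%C * b z x.
Proof. by have := bs.2 k x 0 z; rewrite addr0 sesqui0r addr0. Qed.
Lemma sesquiBl x y z : b (x - y) z = b x z - b y z.
Proof. by apply/eqP; rewrite eq_sym subr_eq -sesquiDl subrK. Qed.
Lemma sesquiBr x y z : b z (x - y) = b z x - b z y.
Proof. by apply/eqP; rewrite eq_sym subr_eq -sesquiDr subrK. Qed.

(** Homogeneity: for nonzero [x] and [y], apply the hypothesis to the normalised vectors, for which
    the sum of squares is 2. *)
Lemma sesqui_le K :
  (forall x y, rnorm (b x y) <= K * (rnorm x ^+ 2 + rnorm y ^+ 2)) ->
  forall x y, rnorm (b x y) <= 2 * K * (rnorm x * rnorm y).
Proof.
move=> bK x y; have [->|x0] := eqVneq x 0.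
  by rewrite sesqui0l !rnorm0 mul0r mulr0.
have [->|y0] := eqVneq y 0; first by rewrite sesqui0r !rnorm0 !mulr0.
have nx0 : rnorm x != 0 by rewrite rnorm_eq0.
have ny0 : rnorm y != 0 by rewrite rnorm_eq0.
have := bK ((rnorm x)^-1%:C *: x) ((rnorm y)^-1%:C *: y).
rewrite sesquiZl sesquiZr conjc_real !rnormM !rnormZ !rnorm_real.
have nV (z : H) : `|(rnorm z)^-1| = (rnorm z)^-1.
  by rewrite ger0_norm ?invr_ge0 ?rnorm_ge0.
rewrite !nV (mulVf nx0) (mulVf ny0) expr1n mulrA -invfM mulrC.
rewrite ler_pdivrMr ?mulr_gt0 ?lt_def ?nx0 ?ny0 ?rnorm_ge0// => /le_trans; apply.
by rewrite ler_wpM2r ?mulr_ge0 ?rnorm_ge0//; lra.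
Qed.

Lemma bounded_form_le K : 0 <= K ->
  (forall x y, rnorm (b x y) <= K * (rnorm x ^+ 2 + rnorm y ^+ 2)) ->
  bounded_form b.
Proof.
by move=> K0 /sesqui_le bK; exists (2 * K); split; first by rewrite mulr_ge0.
Qed.
End SesquiForm.

Definition coercive (s : H -> H -> R[i]) :=
  exists A, 0 < A /\ forall x, A * rnorm x ^+ 2 <= complex.Re (s x x).

Definition hermitian_form (s : H -> H -> R[i]) := forall x y, s y x = (s x y)^*%C.

(** * Representation of functionals and operators by a coercive Hermitian form *)

Section LaxMilgram.
Context (s : H -> H -> R[i]) (ss : sesqui_form s) (sb : bounded_form s)
  (sh : hermitian_form s) (sc : coercive s).

Lemma coercive_eq0 x : (forall y, s y x = 0) -> x = 0.
Proof.
case: sc => A [A0 HA] /(_ x) sx; have := HA x; rewrite sx /=.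
rewrite pmulr_rle0// => x0; apply/eqP; rewrite -rnorm_eq0.
by rewrite -sqrf_eq0 eq_le x0 sqr_ge0.
Qed.

Let q x := complex.Re (s x x).

Let q_expand (t : R) x y :
  q (x + t%:C *: y) = q x + 2 * t * complex.Re (s y x) + t ^+ 2 * q y.
Proof.
rewrite /q (sesquiDl ss) !(sesquiDr ss) !(sesquiZl ss) !(sesquiZr ss) conjc_real.
rewrite (sh y x); case: (s x x) (s y x) (s y y) => [a1 a2] [b1 b2] [c1 c2] /=.
ring.
Qed.

(** Riesz representation by the direct method: [x0] is the limit of a minimising sequence of
    [J x = s x x - 2 Re (phi x)], and the equation is the vanishing of the derivative of [J] at
    [x0]. *)
Lemma representation (phi : H -> R[i]) (M : R) :
  (forall k x y, phi (k *: x + y) = k * phi x + phi y) ->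
  (forall x, rnorm (phi x) <= M * rnorm x) ->
  exists x0, forall y, s y x0 = phi y.
Proof.
move=> phil phiM; have [A [A0 HA]] := sc; have [B [B0 HB]] := sb.
pose J x := q x - 2 * complex.Re (phi x).
have phi0 : phi 0 = 0.
  by apply: (@addIr _ (phi 0)); have := phil 1 0 0; rewrite scale1r mul1r !add0r.
have phiZ k y : phi (k *: y) = k * phi y.
  by have := phil k y 0; rewrite !addr0 phi0 addr0.
have phiD x y : phi (x + y) = phi x + phi y.
  by have := phil 1 x y; rewrite scale1r mul1r.
have J_expand t x y : J (x + t%:C *: y) =
    J x + 2 * t * (complex.Re (s y x) - complex.Re (phi y)) + t ^+ 2 * q y.
  rewrite /J q_expand phiD phiZ; case: (phi x) (phi y) => [? ?] [? ?] /=; ring.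
(* With [n = rnorm x], coercivity gives [J x >= A * n ^+ 2 - 2 * M * n]; complete the square. *)
have J_bd x : - (M ^+ 2 / A) <= J x.
  rewrite /J; have := HA x; rewrite -/(q x).
  have := le_trans (norm_Re_le _) (phiM x); rewrite ler_norml => /andP[_].
  set n := rnorm x => h1 h2.
  have : 0 <= A * (n - M / A) ^+ 2 by rewrite mulr_ge0 ?sqr_ge0 ?ltW.
  have -> : A * (n - M / A) ^+ 2 = A * n ^+ 2 - 2 * M * n + M ^+ 2 / A.
    by field; rewrite gt_eqF.
  lra.
have Jinf : has_inf (range J).
  by split; [exists (J 0), 0|exists (- (M ^+ 2 / A)) => _ [x _ <-]].
pose m := inf (range J).
have mJ x : m <= J x by apply: ge_inf (proj2 Jinf) _ _; exists x.
pose u n : R := n.+1%:R^-1.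
have u0 n : 0 < u n by rewrite invr_gt0 ltr0n.
(* The excess over the infimum is [u n ^+ 2] because distances behave like its square root, hence
   like [u n]. *)
have /choice[x xJ] n : exists x, J x < m + u n ^+ 2.
  by have [_ [x _ <-] xm] := inf_adherent (exprn_gt0 2 (u0 n)) Jinf; exists x.
(* The parallelogram identity makes a minimising sequence Cauchy. *)
have par x1 x2 : q (x1 - x2) = 2 * J x1 + 2 * J x2 - 4 * J (2^-1%:C *: (x1 + x2)).
  rewrite /J phiZ phiD /q !(sesquiZl ss) !(sesquiZr ss) conjc_real.
  rewrite (sesquiBl ss) !(sesquiBr ss) (sesquiDl ss) !(sesquiDr ss).
  case: (s x1 x1) (s x1 x2) (s x2 x1) (s x2 x2) (phi x1) (phi x2) =>
    [? ?] [? ?] [? ?] [? ?] [? ?] [? ?] /=; by field.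
pose c := Num.sqrt A.
have c0 : 0 < c by rewrite sqrtr_gt0.
have Ac : A = c ^+ 2 by rewrite sqr_sqrtr ?ltW.
(* As [J] at the midpoint is at least [m], [par] gives [A * rnorm (x k - x n) ^+ 2 <= 4 * u n ^+ 2]
   for [n <= k]; the rate is the square root of this, with [c ^+ 2 = A]. *)
have [x0 Hx0] : exists x0, forall n, rnorm (x0 - x n) <= 2 / c * u n.
  apply: (@cauchy_limit x (fun n => 2 / c * u n)) => [k n nk|eps];
    last exact: ex_harmonic_lt.
  have kn : u k <= u n by rewrite lef_pV2 ?posrE ?ltr0n// ler_nat ltnS.
  have := le_trans (HA (x k - x n)) (lexx _); rewrite -/(q _) par.
  have := mJ (2^-1%:C *: (x k + x n)); have := xJ k; have := xJ n => h1 h2 h3 h4.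
  have e0 : 0 <= 2 / c * u n by rewrite mulr_ge0 ?divr_ge0 ?(ltW c0) ?(ltW (u0 n)).
  rewrite -(ler_pXn2r (ltn0Sn 1)) ?nnegrE ?rnorm_ge0//.
  have kn2 : u k ^+ 2 <= u n ^+ 2 by rewrite ler_pXn2r ?nnegrE ?(ltW (u0 _)).
  have -> : (2 / c * u n) ^+ 2 = 4 * u n ^+ 2 / A.
    by rewrite Ac; field; rewrite gt_eqF.
  rewrite ler_pdivlMr// mulrC; lra.
exists x0.
(* Real parts suffice: replacing [y] by ['i *: y] recovers the imaginary parts. *)
suff Re0 y : complex.Re (s y x0) = complex.Re (phi y).
  move=> y; have := Re0 ('i%C *: y); rewrite (sesquiZl ss) phiZ.
  have := Re0 y; case: (s y x0) (phi y) => [? ?] [? ?] /= ->.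
  by rewrite !mul0r !mul1r !sub0r => /oppr_inj ->.
(* Adding 1 makes [Q] a safe divisor even for [y = 0], and [1 <= Q] allows [u n ^+ 2 * Q] to be
   bounded by [(Q * u n) ^+ 2]. *)
pose Q := q y + 1.
have Q1 : 1 <= Q.
  rewrite /Q lerDr; apply: le_trans (HA y); by rewrite mulr_ge0 ?sqr_ge0 ?ltW.
have Q0 : 0 < Q by apply: lt_le_trans Q1.
apply/eqP; rewrite -subr_eq0 -normr_le0.
apply: (@le0_harmonic _ (Q + B * (rnorm y * (2 / c)))) => n.
set r := fun z => complex.Re (s y z) - complex.Re (phi y).
have rn : `|r (x n)| <= Q * u n.
  (* A near-optimal descent step along [y]: it lowers [J] by at least [r (x n) ^+ 2 / Q], which
     cannot exceed the excess [u n ^+ 2]. *)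
  have := mJ (x n + (- (r (x n) / Q))%:C *: y); rewrite J_expand -/(r (x n)).
  have := xJ n; move: (r (x n)) => rn h1 h2.
  have Qu0 : 0 <= Q * u n by rewrite mulr_ge0 ?(ltW Q0) ?(ltW (u0 n)).
  rewrite -(ler_pXn2r (ltn0Sn 1)) ?nnegrE// real_normK ?num_real//.
  have h3 : rn ^+ 2 / Q <= u n ^+ 2.
    have : 0 <= (rn / Q) ^+ 2 by exact: sqr_ge0.
    have -> : rn ^+ 2 / Q = 2 * (rn / Q) * rn - (rn / Q) ^+ 2 * Q.
      by field; rewrite gt_eqF.
    rewrite /Q; rewrite sqrrN in h2; lra.
  move: h3; rewrite ler_pdivrMr// => h3; apply: le_trans h3 _.
  by rewrite exprMn mulrC ler_wpM2r ?sqr_ge0// expr2 ler_peMr// ltW.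
rewrite -/(r x0) mulrDl -(subrK (r (x n)) (r x0)) addrC.
apply: le_trans (ler_normD _ _) _; apply: lerD => //.
have -> : r x0 - r (x n) = complex.Re (s y (x0 - x n)).
  by rewrite (sesquiBr ss) /r; case: (s y x0) (s y (x n)) => [? ?] [? ?] /=; ring.
apply: le_trans (norm_Re_le _) _; apply: le_trans (HB _ _) _.
by rewrite -mulrA -mulrA ler_wpM2l// ler_wpM2l ?rnorm_ge0.
Qed.

(** [V x] represents the functional conjugate-dual to [x] under [b]. Uniqueness of the representing
    vector makes [V] linear, and testing with [y = V x] gives [A * rnorm (V x) <= M * rnorm x]. *)
Lemma operator_of_form (b : H -> H -> R[i]) : sesqui_form b -> bounded_form b ->
  exists V : {linear H -> H}, bounded_ops H V /\ forall y x, s y (V x) = b y x.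
Proof.
move=> bs [M [M0 HM]].
have /choice[f fb] x : exists z, forall y, s y z = b y x.
  apply: (@representation (b^~ x) (M * rnorm x)) => [k y z|y]; first exact: bs.1.
  by apply: le_trans (HM _ _) _; rewrite -mulrA (mulrC (rnorm x)).
have fl : linear f.
  move=> k x z; apply/eqP; rewrite -subr_eq0; apply/eqP/coercive_eq0 => y.
  by rewrite (sesquiBr ss) ss.2 !fb bs.2 subrr.
pose V : {linear H -> H} := HB.pack f (GRing.isLinear.Build _ _ _ _ f fl).
exists V; split=> [|y x]; last exact: fb.
have [A [A0 HA]] := sc.
apply/bounded_opsP; exists (M / A); split; first by rewrite divr_ge0// ltW.
move=> x; rewrite /V/=; have [->|fx0] := eqVneq (f x) 0.
  by rewrite rnorm0 mulr_ge0 ?rnorm_ge0// divr_ge0// ltW.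
have fxp : 0 < rnorm (f x) by rewrite lt_def rnorm_eq0 fx0 rnorm_ge0.
rewrite mulrAC ler_pdivlMr// -(ler_pM2r fxp).
have := le_trans (HA (f x)) (le_trans (ler_norm _) (norm_Re_le _)).
rewrite fb => /le_trans /(_ (HM _ _)); rewrite expr2; lra.
Qed.
End LaxMilgram.
End Operators.

(** * Adjoints *)

Section Hilbert.
Context {R : realType} {H : completeNormedModType R[i]}
  (dot : {dot H for (@Num.conj R[i])})
  (dot_norm : forall x : H, dot x x = `|x| ^+ 2).

Lemma dot_sesqui : sesqui_form dot.
Proof.
split=> k x y z; first exact: linearPl.
exact: linearPr.
Qed.

Lemma dot_hermitian : hermitian_form dot.
Proof. by move=> x y; rewrite hermC expr0 mul1r. Qed.

Lemma dot_rnorm x : dot x x = (rnorm x ^+ 2)%:C.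
Proof. by rewrite dot_norm rnormE rmorphXn. Qed.

Lemma dot_coercive : coercive dot.
Proof. by exists 1; split=> // x; rewrite dot_rnorm mul1r. Qed.

(** Both [rnorm (x + y) ^+ 2] and [rnorm (x - y) ^+ 2] are nonnegative; expand them. *)
Lemma norm_Re_dot x y :
  `|complex.Re (dot x y)| <= 2^-1 * (rnorm x ^+ 2 + rnorm y ^+ 2).
Proof.
have := dot_rnorm (x + y); have := dot_rnorm (x - y).
rewrite !(sesquiBl dot_sesqui, sesquiBr dot_sesqui, sesquiDl dot_sesqui,
  sesquiDr dot_sesqui) (dot_hermitian x y) !dot_rnorm.
have := sqr_ge0 (rnorm (x + y)); have := sqr_ge0 (rnorm (x - y)).
move: (rnorm (x + y)) (rnorm (x - y)) => r1 r2; case: (dot x y) => a b /= h1 h2.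
by move=> /(congr1 (@complex.Re R))/= h3 /(congr1 (@complex.Re R))/= h4;
  rewrite ler_norml; lra.
Qed.

(** Cauchy-Schwarz up to a factor 2. The imaginary part is, up to sign, the real part for
    ['i *: x]. *)
Lemma dot_le x y : rnorm (dot x y) <= 2 * (rnorm x * rnorm y).
Proof.
have := sesqui_le dot_sesqui (K := 1); rewrite mulr1; apply=> {}x {}y.
apply: le_trans (rnorm_le_ReIm _) _; rewrite mul1r.
have := norm_Re_dot x y; have := norm_Re_dot ('i%C *: x) y.
have i1 : rnorm ('i%C : R[i]) = 1.
  by rewrite /rnorm normc_def/= expr0n add0r expr1n sqrtr1.
rewrite (sesquiZl dot_sesqui) rnormZ i1 mul1r; case: (dot x y) => a b /=.
by rewrite mul0r mul1r sub0r normrN; lra.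
Qed.

Lemma dot_bounded : bounded_form dot.
Proof. by exists 2; split=> //; exact: dot_le. Qed.

Lemma dot_inj x z : (forall y, dot y x = dot y z) -> x = z.
Proof.
move=> xz; apply/eqP; rewrite -subr_eq0; apply/eqP.
apply: (coercive_eq0 dot_coercive) => y.
by rewrite (sesquiBr dot_sesqui) xz subrr.
Qed.

Definition adjoint (V W : H -> H) := forall y x, dot y (W x) = dot (V y) x.

Lemma adjointC V W : adjoint V W -> adjoint W V.
Proof. by move=> VW y x; rewrite dot_hermitian -VW -dot_hermitian. Qed.

Lemma ex_adjoint (V : {linear H -> H}) : bounded_ops H V ->
  exists W : {linear H -> H}, bounded_ops H W /\ adjoint V W.
Proof.
move=> /bounded_opsP[M [M0 HM]].
apply: (operator_of_form dot_sesqui dot_bounded dot_hermitian dot_coercive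
  (b := fun y x => dot (V y) x)).
  by split=> k x y z; rewrite ?(linearP V);
    [exact: dot_sesqui.1|exact: dot_sesqui.2].
exists (2 * M); split; first by rewrite mulr_ge0.
move=> x y; apply: le_trans (dot_le _ _) _.
by rewrite -mulrA ler_wpM2l// mulrA ler_wpM2r ?rnorm_ge0.
Qed.

Lemma ex_quarter_lt (K e : R) : 0 < e -> exists n, K * 4 ^- n < e.
Proof.
move=> e0; have [n Kn] := ex_harmonic_lt `|K| e0; exists n.
apply: le_lt_trans Kn; apply: (@le_trans _ _ (`|K| * 4 ^- n)).
  by rewrite ler_wpM2r ?ler_norm// invr_ge0 exprn_ge0.
rewrite ler_wpM2l// lef_pV2 ?posrE ?exprn_gt0 ?ltr0n//.
by rewrite -natrX ler_nat ltn_expl.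
Qed.

(* If [W] were not bounded below, unit vectors [g n] with [W (g n)] tiny would
   yield a convergent sum of the [+- 4 ^- n *: g n] outside the range of [V]. *)
Lemma adjoint_bounded_below (V W : H -> H) : adjoint V W ->
  (forall k x, W (k *: x) = k *: W x) -> (forall y, exists x, V x = y) ->
  exists c, 0 < c /\ forall x, c * rnorm x <= rnorm (W x).
Proof.
move=> VW WZ Vsurj; apply: contrapT => Wnb.
(* The factor [4 ^- n] matches the size of the hump [h n]; the extra [n.+1] in the denominator
   produces the final contradiction. *)
have /choice[g Hg] n : exists g, rnorm g = 1 /\ rnorm (W g) <= 4 ^- n / n.+1%:R.
  have c0 : 0 < 4 ^- n / n.+1%:R :> R by rewrite divr_gt0 ?invr_gt0 ?exprn_gt0.
  apply: contrapT => ng; apply: Wnb; exists (4 ^- n / n.+1%:R); split=> // x.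
  have [->|x0] := eqVneq x 0; first by rewrite rnorm0 mulr0 rnorm_ge0.
  have nx0 : 0 < rnorm x by rewrite lt_def rnorm_eq0 x0 rnorm_ge0.
  rewrite leNgt; apply/negP => xW; apply: ng; exists ((rnorm x)^-1%:C *: x).
  rewrite WZ !rnormZ rnorm_real ger0_norm ?invr_ge0 ?rnorm_ge0//.
  by rewrite mulVf ?gt_eqF//; split=> //; rewrite mulrC ler_pdivrMr// ltW.
pose h n : H := (4 ^- n)%:C *: g n.
have hn n : rnorm (h n) = 4 ^- n.
  by rewrite /h rnormZ (Hg n).1 mulr1 rnorm_real ger0_norm// invr_ge0 exprn_ge0.
have hg n : dot (h n) (g n) = (4 ^- n)%:C.
  by rewrite /h (sesquiZl dot_sesqui) dot_rnorm (Hg n).1 expr1n mulr1.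
pose s := fix s n := if n is k.+1 then
  if 4 ^- k <= rnorm (dot (s k + h k) (g k)) then s k + h k else s k - h k else 0.
have sS n : rnorm (s n.+1 - s n) = 4 ^- n.
  by rewrite /=; case: ifP => _; rewrite addrAC subrr add0r ?rnormN hn.
(* The two candidate values [a + 4 ^- n] and [a - 4 ^- n] differ by [2 * 4 ^- n], so one of them has
   modulus at least [4 ^- n]; [s] picks its sign accordingly. *)
have sg n : 4 ^- n <= rnorm (dot (s n.+1) (g n)).
  rewrite /=; case: ifP => // /negbT; rewrite -ltNge.
  rewrite (sesquiBl dot_sesqui) (sesquiDl dot_sesqui) hg.
  move: (dot (s n) (g n)) => a.
  have := ler_rnormB (a + (4 ^- n)%:C) (a - (4 ^- n)%:C).
  rewrite opprB addrCA addrAC subrr add0r -rmorphD/= rnorm_real.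
  have p0 : 0 <= 4 ^- n :> R by rewrite invr_ge0 exprn_ge0.
  rewrite ger0_norm ?addr_ge0//; lra.
have sk n k : rnorm (s (n + k)%N - s n) <= 4 / 3 * (4 ^- n - 4 ^- (n + k)).
  elim: k => [|k IH]; first by rewrite addn0 !subrr rnorm0 mulr0.
  rewrite addnS -(subrK (s (n + k)%N) (s _.+1)) -addrA.
  apply: le_trans (ler_rnormD _ _) _; rewrite sS.
  have -> : 4 ^- (n + k).+1 = 4^-1 * 4 ^- (n + k) :> R by rewrite exprS invfM.
  by move: IH; lra.
have [x Hx] : exists x, forall n, rnorm (x - s n) <= 4 / 3 * 4 ^- n.
  apply: (@cauchy_limit _ _ s (fun n => 4 / 3 * 4 ^- n)) => [m n nm|eps].
    rewrite -(subnKC nm); apply: le_trans (sk _ _) _.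
    by rewrite ler_wpM2l ?divr_ge0// gerBl invr_ge0 exprn_ge0.
  exact: ex_quarter_lt.
have [z Vz] := Vsurj x.
have : 3^-1 <= 0 :> R.
  apply: (@le0_harmonic _ (2 * rnorm z)) => n.
  have p0 : 0 < 4 ^- n :> R by rewrite invr_gt0 exprn_gt0.
  rewrite -(ler_pM2r p0).
  have h1 : rnorm (dot x (g n)) <= 2 * (rnorm z * (4 ^- n / n.+1%:R)).
    rewrite -Vz -VW; apply: le_trans (dot_le _ _) _.
    by rewrite ler_wpM2l// ler_wpM2l ?rnorm_ge0// (Hg n).2.
  (* The tail after [s n.+1] has norm at most [3^-1 * 4 ^- n]. Even after the factor 2 of [dot_le]
     it leaves a third of the hump; this is what the ratio 4 is for. *)
  have h2 : rnorm (dot (x - s n.+1) (g n)) <= 2 / 3 * 4 ^- n.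
    apply: le_trans (dot_le _ _) _; rewrite (Hg n).1 mulr1.
    have := Hx n.+1; have -> : 4 ^- n.+1 = 4^-1 * 4 ^- n :> R by rewrite exprS invfM.
    lra.
  have h3 := sg n.
  have h4 : rnorm (dot (s n.+1) (g n)) <=
      rnorm (dot x (g n)) + rnorm (dot (x - s n.+1) (g n)).
    by apply: le_trans (ler_rnormB _ _); rewrite (sesquiBl dot_sesqui) subKr.
  have -> : 2 * rnorm z / n.+1%:R * 4 ^- n = 2 * (rnorm z * (4 ^- n / n.+1%:R)).
    by rewrite -!mulrA (mulrC n.+1%:R^-1).
  apply: le_trans h1; move: (4 ^- n) p0 h2 h3 h4 => p p0; lra.
by rewrite leNgt invr_gt0 ltr0n.
Qed.

(** Since [W] is bounded below, the form [<W y, W x>] is coercive, and the normal equation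
    [<W z, W y> = <W z, x>] is solvable in [y]. It says [V (W y) = V x], and [V] is injective. *)
Lemma adjoint_surjective (V W : {linear H -> H}) : adjoint V W ->
  bounded_ops H W -> bijective V -> forall x, exists y, W y = x.
Proof.
move=> VW Wb Vbij x; have [V' V'V VV'] := Vbij.
have [c [c0 Hc]] : exists c, 0 < c /\ forall x, c * rnorm x <= rnorm (W x).
  apply: (adjoint_bounded_below VW) => [k y|y]; first exact: linearZ.
  by exists (V' y).
have /bounded_opsP[M [M0 HM]] := Wb.
have WWs : sesqui_form (fun y x => dot (W y) (W x)).
  by split=> k y y' z; rewrite (linearP W);
    [exact: dot_sesqui.1|exact: dot_sesqui.2].
have WWb : bounded_form (fun y x => dot (W y) (W x)).
  exists (2 * (M * M)); split; first by rewrite !mulr_ge0.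
  move=> y z; apply: le_trans (dot_le _ _) _.
  by rewrite -mulrA ler_wpM2l// mulrACA ler_pM ?rnorm_ge0.
have WWh : hermitian_form (fun y x => dot (W y) (W x)).
  by move=> y z; exact: dot_hermitian.
have WWc : coercive (fun y x => dot (W y) (W x)).
  exists (c ^+ 2); split=> [|y]; first exact: exprn_gt0.
  by rewrite dot_rnorm/= -exprMn ler_pXn2r ?nnegrE ?mulr_ge0 ?rnorm_ge0 ?(ltW c0).
have [y Wy] : exists y, forall z, dot (W z) (W y) = dot (W z) x.
  apply: (representation WWs WWb WWh WWc (phi := fun y => dot (W y) x)
    (M := 2 * M * rnorm x)) => [k y y'|y].
    by rewrite (linearP W); exact: dot_sesqui.1.
  apply: le_trans (dot_le _ _) _.
  by rewrite -!mulrA ler_wpM2l// (mulrC (rnorm x)) mulrA ler_wpM2r ?rnorm_ge0.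
exists y; apply: (bij_inj Vbij); apply: dot_inj => z.
by rewrite !(adjointC VW).
Qed.
End Hilbert.

(** * Frames *)

(** The form of induction suited to powers of a bijection: a step that can be undone serves both
    directions of [Z]. *)
Lemma int_ind_iff (P : int -> Prop) :
  P 0 -> (forall n, P n <-> P (n + 1)) -> forall n, P n.
Proof.
move=> P0 PS; elim/int_ind => [//|n /PS|n Pn]; first by rewrite intS addrC.
by apply/PS; rewrite intS opprD addrC addNKr.
Qed.

Section Frames.
Context {R : realType} {H : completeNormedModType R[i]}
  (dot : {dot H for (@Num.conj R[i])})
  (dot_norm : forall x : H, dot x x = `|x| ^+ 2).

Section Dual.
Context {I : choiceType} (u : I -> H) (u_frame : frame dot u).

Definition analysis x : I -> R[i] := fun i => dot x (u i).

Lemma frame_l2 x : l2 (analysis x).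
Proof.
case: u_frame => A [B [A0 B0 /(_ x)[_ HB]]].
by apply: le_lt_trans HB _; rewrite ltry.
Qed.

Lemma frame_bounds : exists A B : R, [/\ 0 < A, 0 < B & forall x,
  A * rnorm x ^+ 2 <= l2norm2 (analysis x) <= B * rnorm x ^+ 2].
Proof.
case: u_frame => A [B [A0 B0 HAB]]; exists A, B; split=> // x.
have [lA lB] := HAB x; rewrite -2!lee_fin /l2norm2 fineK; first by rewrite lA lB.
by apply: summable_real_fin (frame_l2 x) => i; rewrite sqr_ge0.
Qed.
End Dual.

Section Pairing.
Context {I : choiceType} (u v : I -> H) (u_frame : frame dot u)
  (v_frame : frame dot v).

(** The form [<y, S x>] of the mixed frame operator [S x = sum_i <x, u i> v i]; for [u = v] this is
    the frame operator. *)
Definition frame_pairing (y x : H) := l2dot (analysis v y) (analysis u x).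

Lemma frame_pairing_sesqui : sesqui_form frame_pairing.
Proof.
have anP w k x y : analysis w (k *: x + y) =
    (fun i : I => k * analysis w x i + analysis w y i).
  by apply/funext => i; rewrite /analysis (dot_sesqui dot).1.
have lu := frame_l2 u_frame; have lv := frame_l2 v_frame.
split=> k x y z; rewrite /frame_pairing anP; first by rewrite l2dot_linear.
rewrite l2dotC l2dot_linear// (l2dotC (analysis u x)) (l2dotC (analysis u y)).
by rewrite rmorphD rmorphM.
Qed.

Lemma frame_pairing_bounded : bounded_form frame_pairing.
Proof.
have [A [B [_ B0 HB]]] := frame_bounds u_frame.
have [A' [B' [_ B'0 HB']]] := frame_bounds v_frame.
apply: (bounded_form_le frame_pairing_sesqui (K := B + B')) => [|y x].
  by rewrite addr_ge0 ?ltW.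
apply: le_trans (l2dot_le (frame_l2 v_frame y) (frame_l2 u_frame x)) _.
have /andP[_ h1] := HB x; have /andP[_ h2] := HB' y.
have := mulr_ge0 (ltW B0) (sqr_ge0 (rnorm y)).
have := mulr_ge0 (ltW B'0) (sqr_ge0 (rnorm x)); lra.
Qed.
End Pairing.

(* [D] is the inverse of the frame operator of [u]. *)
Definition dual_operator (I : choiceType) (u : I -> H) (D : H -> H) :=
  forall y x, l2dot (analysis u y) (analysis u (D x)) = dot y x.

Section Dual.
Context {I : choiceType} (u : I -> H) (u_frame : frame dot u).

Lemma frame_pairing_hermitian : hermitian_form (frame_pairing u u).
Proof. by move=> x y; rewrite /frame_pairing l2dotC. Qed.

Lemma frame_pairing_coercive : coercive (frame_pairing u u).
Proof.
have [A [B [A0 _ HA]]] := frame_bounds u_frame; exists A; split=> // x.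
by rewrite /frame_pairing l2dotaa; [case/andP: (HA x)|exact: frame_l2].
Qed.

(** The lower frame bound is coercivity of the frame operator, so the Lax-Milgram argument inverts
    it. *)
Lemma ex_dual_operator :
  exists D : {linear H -> H}, bounded_ops H D /\ dual_operator u D.
Proof.
exact: operator_of_form (frame_pairing_sesqui u_frame u_frame)
  (frame_pairing_bounded u_frame u_frame) frame_pairing_hermitian
  frame_pairing_coercive _ (dot_sesqui dot) (dot_bounded dot_norm).
Qed.

Lemma dual_operator_inj D x z : dual_operator u D ->
  (forall y, l2dot (analysis u y) (analysis u z) = dot y x) -> z = D x.
Proof.
move=> uD zx; apply/eqP; rewrite -subr_eq0; apply/eqP.
apply: (coercive_eq0 frame_pairing_coercive) => y.
rewrite (sesquiBr (frame_pairing_sesqui u_frame u_frame)).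
by rewrite /frame_pairing zx uD subrr.
Qed.

(** Both sides are the [l^2] product of the coefficients of [D x] and [D y]. *)
Lemma dual_operator_sym D x y : dual_operator u D -> dot (D x) y = dot x (D y).
Proof.
by move=> uD; rewrite -uD (dot_hermitian dot (D y)) -uD -l2dotC.
Qed.
End Dual.
End Frames.

(** * Integer powers of a bijection *)

Section Zpow.
Context {R : realType} {H : completeNormedModType R[i]} (T : H -> H)
  (T_bij : bijective T).

Lemma zpowS n x : zpow T (n + 1) x = T (zpow T n x).
Proof.
case: n => [n|n]; first by rewrite -PoszD addn1.
have TK y : T ('pinv_(fun=> 0) [set: H] T y) = y.
  by apply: pinvK; rewrite inE; have [T' _ K] := T_bij; exists (T' y).
(* The exponent -1 is apart: its successor 0 falls in the [Posz] branch of [zpow]. *)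
case: n => [|n]; first by rewrite (_ : Negz 0 + 1 = 0)//= TK.
have -> : Negz n.+1 + 1 = Negz n by rewrite !NegzE -[n.+2]addn1 PoszD opprD addrNK.
by rewrite /= TK.
Qed.

(** For negative exponents, injectivity of [T] lets one factor [T] be cancelled from the identity
    one step higher. *)
Lemma zpow_comm (V : H -> H) n x : (forall y, V (T y) = T (V y)) ->
  zpow T n (V x) = V (zpow T n x).
Proof.
move=> VT; elim/int_ind_iff: n => [//|n]; rewrite !zpowS VT; split=> [->//|].
exact: bij_inj.
Qed.
End Zpow.

(** * Frames generated by the integer powers of one operator *)

Section Generators.
Context {R : realType} {H : completeNormedModType R[i]}
  (dot : {dot H for (@Num.conj R[i])})
  (dot_norm : forall x : H, dot x x = `|x| ^+ 2)
  (T T' : {linear H -> H}) (T_bij : bijective T) (TT' : adjoint dot T T')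
  (T'_surj : forall x, exists y, T' y = x).

Section Covariance.
Context (f : H) (f_frame : frame_generators dot T f)
  (D : H -> H) (fD : dual_operator dot (fun n : int => zpow T n f) D).

Lemma analysis_adjoint x n :
  analysis dot (fun n : int => zpow T n f) (T' x) n =
  analysis dot (fun n : int => zpow T n f) x (n + 1).
Proof. by rewrite /analysis zpowS// (adjointC TT'). Qed.

(** Test against [y = T' z], which is every vector. By [analysis_adjoint], [T'] shifts coefficients,
    and a common shift leaves the [l^2] product unchanged. *)
Lemma dual_operator_conj x : T' (D (T x)) = D x.
Proof.
apply: (dual_operator_inj f_frame fD) => y; have [z <-] := T'_surj y.
rewrite -(adjointC TT') -(fD z).
rewrite -[RHS](reindex_l2dot (e := fun n : int => n + 1)); last first.
  by exists (fun n => n - 1) => n; rewrite ?addrK ?subrK.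
by apply: eq_l2dot => n; rewrite analysis_adjoint.
Qed.

(** This is the Laurent property of all Gram matrices below: moving [T] across the product trades
    [D] for [T' D T = D]. *)
Lemma dual_operator_zpow m n x y :
  dot (D (zpow T m x)) (zpow T n y) = dot (D x) (zpow T (n - m) y).
Proof.
elim/int_ind_iff: m n => [n|m]; first by rewrite subr0.
have shift n : dot (D (zpow T (m + 1) x)) (zpow T n y) =
    dot (D (zpow T m x)) (zpow T (n - 1) y).
  rewrite -{1}(subrK 1 n) !zpowS// (adjointC TT').
  by rewrite dual_operator_conj.
split=> E n; first by rewrite shift E opprD addrA addrAC.
by rewrite -[in LHS](addrK 1 n) -shift E opprD addrA addrAC addrK.
Qed.
End Covariance.

Section TwoGenerators.
Context (f0 f1 : H) (f0_frame : frame_generators dot T f0)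
  (f1_frame : frame_generators dot T f1) (D0 D1 : {linear H -> H})
  (D0_bd : bounded_ops H D0)
  (D0P : dual_operator dot (fun n : int => zpow T n f0) D0)
  (D1P : dual_operator dot (fun n : int => zpow T n f1) D1).

Let u0 (n : int) := zpow T n f0.
Let u1 (n : int) := zpow T n f1.

(** The equality [G_0 = G_1], read on the row of index 0 of these Laurent matrices. *)
Lemma dual_autocorrelation m : dot (D0 f0) (u0 m) = dot (D1 f1) (u1 m).
Proof.
have D0s x y := dual_operator_sym x y D0P.
have D1s x y := dual_operator_sym x y D1P.
have Z0 m' n x y : _ = _ := dual_operator_zpow f0_frame D0P m' n x y.
have Z1 m' n x y : _ = _ := dual_operator_zpow f1_frame D1P m' n x y.
have hC := dot_hermitian dot.
pose a (k : int) := dot (D0 f0) (u1 k).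
pose b (k : int) := dot (D1 f0) (u1 (k + m)).
(* Expanding through the second frame writes an entry of [G_0] as a product of cross Gram
   entries. *)
have E0 : dot (D0 f0) (u0 (- m)) = l2dot a b.
  rewrite -(D1P (D0 f0)); apply: eq_l2dot => [//|k].
  by rewrite /analysis Z1 opprK.
have -> : dot (D0 f0) (u0 m) = l2dot b a.
  by rewrite l2dotC -E0 -hC -D0s (Z0 _ 0) sub0r opprK.
(* Now an entry of [G_1] is expanded through the first frame. The same cross entries appear,
   conjugated and in reversed order, so the substitution [k -> - k] is the commutativity of
   convolution. *)
rewrite D1s hC -(D0P (D1 (u1 m))) -l2dotC.
rewrite -l2dotJ -[RHS](reindex_l2dot (e := fun k : int => - k)); last first.
  by exists -%R; exact: opprK.
apply: eq_l2dot => k.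
  by rewrite /analysis D0s hC; rewrite (Z0 _ 0) sub0r opprK.
by rewrite /analysis hC -D1s Z1 opprK addrC.
Qed.

(** The last two conclusions prepare the inverse: [intertwiner_inv] combines the weak formula of one
    intertwiner with the coefficient identity of the one in the opposite direction. *)
Lemma ex_intertwiner : exists V : {linear H -> H},
  [/\ bounded_ops H V, forall x, V (T x) = T (V x), V f0 = f1,
    forall y x, dot y (V x) = l2dot (analysis dot u1 y) (analysis dot u0 (D0 x)) &
    forall x n, dot (D1 (V x)) (u1 n) = dot (D0 x) (u0 n)].
Proof.
have D0s x y := dual_operator_sym x y D0P.
have D1s x y := dual_operator_sym x y D1P.
have Z0 := dual_operator_zpow f0_frame D0P.
have Z1 := dual_operator_zpow f1_frame D1P.
have hC := dot_hermitian dot.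
have [M [M0 HM]] := frame_pairing_bounded f0_frame f1_frame.
have pS := frame_pairing_sesqui f0_frame f1_frame.
have /bounded_opsP[M' [M'0 HM']] := D0_bd.
have [||V [Vb HV]] := operator_of_form (dot_sesqui dot) (dot_bounded dot_norm)
  (dot_hermitian dot) (dot_coercive dot_norm)
  (b := fun y x => frame_pairing dot u0 u1 y (D0 x)).
- by split=> k x y z; rewrite ?(linearP D0); [exact: pS.1|exact: pS.2].
- exists (M * M'); split; first by rewrite mulr_ge0.
  move=> x y; apply: le_trans (HM _ _) _; rewrite -mulrA ler_wpM2l//.
  by rewrite mulrCA ler_wpM2l ?rnorm_ge0.
exists V; split=> //.
- move=> x; apply: (dot_inj dot_norm) => y.
  rewrite (adjointC TT') !HV /frame_pairing.
  rewrite -[LHS](reindex_l2dot (e := fun n : int => n + 1)); last first.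
    by exists (fun n => n - 1) => n; rewrite ?addrK ?subrK.
  apply: eq_l2dot => n; first by rewrite -analysis_adjoint.
  by rewrite /analysis /u0 zpowS// (adjointC TT') (dual_operator_conj f0_frame D0P).
- apply: (dot_inj dot_norm) => y; rewrite HV -(D1P y f1).
  by apply: eq_l2dot => [//|n]; exact: dual_autocorrelation.
(* Both sides expand as products with the coefficients of [D0 x], against row [n] of [G_1] and of
   [G_0], and these rows agree. *)
move=> x n; rewrite D1s hC HV -l2dotC -(D0P (D0 x)).
apply: eq_l2dot => [//|k].
by rewrite /analysis /u0 /u1 Z0 Z1 -dual_autocorrelation.
Qed.
End TwoGenerators.
End Generators.

(** [<y, W (V x)>] pairs the [u]-coefficients of [y] with the [v]-coefficients of [E (V x)]; these
    are the [u]-coefficients of [D x], and [D] inverts the frame operator of [u]. *)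
Lemma intertwiner_inv (R : realType) (H : completeNormedModType R[i])
    (dot : {dot H for (@Num.conj R[i])})
    (dot_norm : forall x : H, dot x x = `|x| ^+ 2)
    (I : choiceType) (u v : I -> H) (D E V W : H -> H) :
  dual_operator dot u D ->
  (forall y x, dot y (W x) = l2dot (analysis dot u y) (analysis dot v (E x))) ->
  (forall x i, dot (E (V x)) (v i) = dot (D x) (u i)) ->
  cancel V W.
Proof.
move=> uD HW HV x; apply: (dot_inj dot_norm) => y.
by rewrite HW -uD; apply: eq_l2dot => [//|i]; exact: HV.
Qed.

Lemma frame_image (R : realType) (H : completeNormedModType R[i])
    (dot : {dot H for (@Num.conj R[i])})
    (dot_norm : forall x : H, dot x x = `|x| ^+ 2)
    (I : choiceType) (u : I -> H) (V : {linear H -> H}) :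
  GL H V -> frame dot u -> frame dot (V \o u).
Proof.
move=> [Vb Vbij] [A [B [A0 B0 HAB]]].
have [W [Wb VW]] := ex_adjoint dot_norm Vb.
have [c [c0 Hc]] : exists c, 0 < c /\ forall x, c * rnorm x <= rnorm (W x).
  apply: (adjoint_bounded_below dot_norm VW) => [k y|y]; first exact: linearZ.
  by have [V' _ V'K] := Vbij; exists (V' y).
have /bounded_opsP[M [M0 HM]] := Wb.
(* The constants [c] and [M] bound the adjoint [W] below and above; [M + 1] keeps the upper frame
   bound positive when [M = 0]. *)
exists (A * c ^+ 2), (B * (M + 1) ^+ 2); split.
- by rewrite mulr_gt0 ?exprn_gt0.
- by rewrite mulr_gt0 ?exprn_gt0 ?ltr_wpDl.
move=> f; have [HA HB] := HAB (W f).
under eq_esum do rewrite /= (adjointC VW).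
split.
  apply: le_trans HA; rewrite lee_fin -mulrA ler_wpM2l ?(ltW A0)// -exprMn.
  by rewrite ler_pXn2r ?nnegrE ?mulr_ge0 ?rnorm_ge0 ?(ltW c0).
apply: le_trans HB _; rewrite lee_fin -mulrA ler_wpM2l ?(ltW B0)// -exprMn.
rewrite ler_pXn2r ?nnegrE ?mulr_ge0 ?rnorm_ge0 ?addr_ge0//.
by apply: le_trans (HM f) _; rewrite ler_wpM2r ?rnorm_ge0// lerDl.
Qed.

Theorem proposition4p11 (R : realType) (H : completeNormedModType R[i])
    (dot : {dot H for (@Num.conj R[i])})
    (dot_norm : forall x : H, dot x x = `|x| ^+ 2)
    (H_separable : separable H) (H_infinite_dimensional : infinite_dimensional H)
    (T : {linear H -> H}) (T_GL : GL H T)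
    (f0 : H) (f0_frame : frame_generators dot T f0) :
  frame_generators dot T = [set V f0 | V in commutant T `&` GL H].
Proof.
have [Tb Tbij] := T_GL; have [T' [T'b TT']] := ex_adjoint dot_norm Tb.
have T'_surj := adjoint_surjective dot_norm TT' T'b Tbij.
apply/seteqP; split=> [f1 f1_frame|_ [V [[_ VT] VGL] <-]]; last first.
  have VTx y : V (T y) = T (V y) by have := congr1 (fun h => h y) VT.
  rewrite /frame_generators/=.
  (* The orbit of [V f0] is the image under [V] of the orbit of [f0]. *)
  have -> : (fun n : int => zpow T n (V f0)) = V \o (fun n : int => zpow T n f0).
    by apply/funext => n /=; exact: zpow_comm.
  exact: frame_image.
have [D0 [D0b D0P]] := ex_dual_operator dot_norm f0_frame.
have [D1 [D1b D1P]] := ex_dual_operator dot_norm f1_frame.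
have [V [Vb VT Vf VE VK]] := ex_intertwiner dot_norm Tbij TT' T'_surj
  f0_frame f1_frame D0b D0P D1P.
have [W [Wb WT Wf WE WK]] := ex_intertwiner dot_norm Tbij TT' T'_surj
  f1_frame f0_frame D1b D1P D0P.
exists V => //; split; split=> //=; first by apply/funext => x /=.
exists W; first exact: (intertwiner_inv dot_norm D0P WE VK).
exact: (intertwiner_inv dot_norm D1P VE WK).
Qed.
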